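(* Let $\{x^{ag}_k\}$ be the iterates generated by the UPFAG algorithm (described in the context) applied to the problem $\Psi^*=\min_{x\in X}\{\Psi(x)=f(x)+\mathcal{X}(x)\}$, where $f$ satisfies $\|f'(y)-f'(x)\|\le H\|y-x\|^\nu$ on $X$ for some $H>0$ and $\nu\in[0,1]$. Suppose there exist constants $\lambda>0$ and $\beta>0$ such that the initial stepsizes satisfy $\hat\lambda_k\ge\lambda$ and $\hat\beta_k\ge\beta$ for all $k\ge1$. Let $$L(\nu,H)=\left\{\frac{H}{2\left[\frac{1+\nu}{1-\nu}\right]^{\frac{1-\nu}{2}}}\right\}^{\frac{2}{1+\nu}}\ \text{ for }\nu\in[0,1),\qquad L(1,H)=\lim_{\nu\to1}L(\nu,H)=\frac H2.$$ (a) Suppose that $\Psi$ is bounded below over $X$, i.e., $\Psi^*$ is finite. Then, for any $N\ge1$, we have $$\min_{k=1,\ldots,N}\|\hat g_{X,k}\|^2\le\frac{8[\Psi(x_0)-\Psi^*+1]}{\gamma\,\gamma_2}\left[\frac{8L(\nu,H)}{(2\sigma-\gamma)N^{\frac{2\nu}{1+\nu}}}+\frac1{\beta N}\right],$$ where $\hat g_{X,k}=(x^{ag}_{k-1}-\bar x^{ag}_k)/\beta_k$. (b) Suppose that $f$ is convex and an optimal solution $x^*$ exists for the problem $\min_{x\in X}\Psi(x)$. Then for any $N\ge1$, we have $$\Psi(x^{ag}_N)-\Psi(x^* )\le\frac{4\|x_0-x^*\|^2}{\gamma_1N^{\frac{1+3\nu}{1+\nu}}}\left[\frac{2L(\nu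,H)}{\delta^{\frac{1-\nu}{1+\nu}}}+\frac1\lambda\right]+\delta.$$
   Context: Setting: $X\subseteq\mathbb{R}^n$ is a closed convex set, $f:X\to\mathbb{R}$ is possibly nonconvex with gradient $f'$ (in the case $\nu=0$, nonsmooth convex $f$ with $f'(x)$ a subgradient is also allowed), $\mathcal{X}$ is a (possibly nondifferentiable) convex real-valued function on $X$, $\Psi:=f+\mathcal{X}$, and $\Psi^*:=\min_{x\in X}\Psi(x)$ denotes the optimal value (infimum). $\|\cdot\|$ is the Euclidean norm and $\|x\|_G=\sqrt{\langle Gx,x\rangle}$ for positive definite $G$. There are $H>0$, $\nu\in[0,1]$ with $\|f'(y)-f'(x)\|\le H\|y-x\|^\nu$ for all $x,y\in X$; consequently $|f(y)-f(x)-\langle f'(x),y-x\rangle|\le\frac{H}{1+\nu}\|y-x\|^{1+\nu}$ for all $x,y\in X$. UPFAG algorithm. Input: $x_0\in X$, line search parameters $0<\gamma<\sigma<1$, $\gamma_1,\gamma_2\in(0,1)$, and accuracy parameter $\delta>0$. Set $x^{ag}_0=x_0$, $\Lambda_0=0$. For $k=1,2,\ldots$: 1. Choose an initial stepsize $\hat\lambda_k>0$ and find the smallest integer $\tau_{1,k}\ge0$ such that with $\eta_k=\hat\lambda_k\gamma_1^{\tau_{1,k}}$, $\lambda_k=\frac12\left(\eta_k+\sqrt{\eta_k^2+4\eta_k\Lambda_{k-1}}\right)$, $\Lambda_k=\sum_{i=1}^k\lambda_i$, $\alpha_k=\lambda_k/\Lambda_k$, the points $x^{md}_k=(1-\alpha_k)x^{ag}_{k-1}+\alpha_kx_{k-1}$,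 $x_k=\arg\min_{u\in X}\{\langle f'(x^{md}_k),u\rangle+\frac1{2\lambda_k}\|u-x_{k-1}\|^2+\mathcal{X}(u)\}$, $\tilde x^{ag}_k=(1-\alpha_k)x^{ag}_{k-1}+\alpha_kx_k$ satisfy the line search condition $f(\tilde x^{ag}_k)\le f(x^{md}_k)+\alpha_k\langle f'(x^{md}_k),x_k-x_{k-1}\rangle+\frac{\alpha_k}{2\lambda_k}\|x_k-x_{k-1}\|^2+\delta\alpha_k$. 2. Choose an initial stepsize $\hat\beta_k>0$ and a symmetric matrix $G_k\succeq\sigma I$, and find the smallest integer $\tau_{2,k}\ge0$ such that with $\beta_k=\hat\beta_k\gamma_2^{\tau_{2,k}}$ and $\bar x^{ag}_k=\arg\min_{u\in X}\{\langle f'(x^{ag}_{k-1}),u\rangle+\frac1{2\beta_k}\|u-x^{ag}_{k-1}\|_{G_k}^2+\mathcal{X}(u)\}$, the line search condition $\Psi(\bar x^{ag}_k)\le\Psi(x^{ag}_{k-1})-\frac{\gamma}{2\beta_k}\|\bar x^{ag}_k-x^{ag}_{k-1}\|^2+\frac1k$ holds. 3. Choose $x^{ag}_k\in\{x^{ag}_{k-1},\bar x^{ag}_k,\tilde x^{ag}_k\}$ such that $\Psi(x^{ag}_k)=\min\{\Psi(x^{ag}_{k-1}),\Psi(\bar x^{ag}_k),\Psi(\tilde x^{ag}_k)\}$. The minimizers in the subproblems are assumed to exist. *)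

(* Defs.v *)
From HB Require Import structures.
From mathcomp Require Import all_boot all_order all_algebra.
From mathcomp Require Import all_classical all_reals all_analysis.
From mathcomp Require Import ring lra.

Set Implicit Arguments.
Unset Strict Implicit.
Unset Printing Implicit Defensive.
Import Order.TTheory GRing.Theory Num.Theory.
Import numFieldNormedType.Exports.
Local Open Scope classical_set_scope.
Local Open Scope ring_scope.

Section Euclidean.
Context {R : realType} {n : nat}.
Implicit Types (u v : 'cV[R]_n) (G : 'M[R]_n).

Definition dot u v : R := \sum_i u i 0 * v i 0.

(* The library norm on matrices is the max norm, hence this one; the two      *)
(* induce the same topology.                                                  *)
Definition enorm u : R := Num.sqrt (dot u u).

Definition enormG G u : R := Num.sqrt (dot (G *m u) u).

Definition symmetric G := G^T = G.

Definition loewner_ge G1 G2 := forall u, 0 <= dot ((G1 - G2) *m u) u.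

End Euclidean.

Section Problem.
Context {R : realType} {n : nat}.
Local Notation V := 'cV[R]_n.
Implicit Types (X : set V) (f phi : V -> R) (df : V -> V) (x y : V).

Definition is_argmin X phi x := X x /\ forall u, X u -> phi x <= phi u.

(* f stands for a function on X only: its values outside X must not matter,   *)
(* so the first-order expansion is relative to X. Ordinary differentiability  *)
(* at the points of X is a special case (is_diff_gradient_on).                *)
Definition gradient_on X f df := forall x, X x ->
  forall e, 0 < e -> \forall y \near within X (nbhs x),
    `|f y - f x - dot (df x) (y - x)| <= e * enorm (y - x).

Definition subgradient_on X f df := forall x y, X x -> X y ->
  f x + dot (df x) (y - x) <= f y.

Definition hoelder_on X (H nu : R) df := forall x y, X x -> X y ->
  enorm (df y - df x) <= H * enorm (y - x) `^ nu.

(* f' is the gradient of a possibly nonconvex f, or, for nu = 0 only, a       *)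
(* selection of subgradients of a possibly nonsmooth convex f.                *)
Definition smooth_or_subgradient X f df (nu : R) :=
  gradient_on X f df \/
  [/\ nu = 0, convex_function X f & subgradient_on X f df].

End Problem.

(* The value at nu = 1 is the limit of the other branch: hoelder_const_cvg1.  *)
Definition hoelder_const {R : realType} (nu H : R) : R :=
  if nu == 1 then H / 2
  else (H / (2 * ((1 + nu) / (1 - nu)) `^ ((1 - nu) / 2))) `^ (2 / (1 + nu)).

Section Method.
Context {R : realType} {n : nat}.
Local Notation V := 'cV[R]_n.

(* The positive root of l ^ 2 = eta * (Lam + l).                              *)
Definition ag_step (eta Lam : R) : R :=
  (eta + Num.sqrt (eta ^+ 2 + 4 * eta * Lam)) / 2.

Definition ag_weight (eta Lam : R) : R :=
  ag_step eta Lam / (Lam + ag_step eta Lam).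

Definition ag_comb (alpha : R) (z u : V) : V := (1 - alpha) *: z + alpha *: u.

(* One execution of the method. Entry 0 of xag and xk is the initialization;  *)
(* every other field is meaningful for iterations k >= 1 only. trial1 k j and *)
(* trial2 k j are the subproblem minimizers computed at iteration k for the   *)
(* j-th trial stepsizes hlambda k * gamma1 ^+ j and hbeta k * gamma2 ^+ j.    *)
Record upfag_trace := UpfagTrace {
  hlambda : nat -> R;
  tau1 : nat -> nat;
  trial1 : nat -> nat -> V;
  lamk : nat -> R;
  xk : nat -> V;
  hbeta : nat -> R;
  Gk : nat -> 'M[R]_n;
  tau2 : nat -> nat;
  trial2 : nat -> nat -> V;
  xag : nat -> V
}.

Variables (X : set V) (f chi : V -> R) (df : V -> V).
Variables (gamma sigma gamma1 gamma2 delta : R).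
Variable t : upfag_trace.

Definition Lamk k : R := \sum_(1 <= i < k.+1) lamk t i.

Definition trial_eta k j : R := hlambda t k * gamma1 ^+ j.
Definition trial_lambda k j : R := ag_step (trial_eta k j) (Lamk k.-1).
Definition trial_alpha k j : R := ag_weight (trial_eta k j) (Lamk k.-1).
Definition trial_xmd k j : V :=
  ag_comb (trial_alpha k j) (xag t k.-1) (xk t k.-1).
Definition trial_xtilde k j : V :=
  ag_comb (trial_alpha k j) (xag t k.-1) (trial1 t k j).

Definition subproblem1 k j (u : V) : R :=
  dot (df (trial_xmd k j)) u
  + (2 * trial_lambda k j)^-1 * enorm (u - xk t k.-1) ^+ 2 + chi u.

Definition linesearch1 k j :=
  let a := trial_alpha k j in
  let d := trial1 t k j - xk t k.-1 in
  f (trial_xtilde k j) <=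
    f (trial_xmd k j) + a * dot (df (trial_xmd k j)) d
    + a / (2 * trial_lambda k j) * enorm d ^+ 2 + delta * a.

Definition trial_beta k j : R := hbeta t k * gamma2 ^+ j.

Definition subproblem2 k j (u : V) : R :=
  dot (df (xag t k.-1)) u
  + (2 * trial_beta k j)^-1 * enormG (Gk t k) (u - xag t k.-1) ^+ 2 + chi u.

Definition linesearch2 k j :=
  f (trial2 t k j) + chi (trial2 t k j) <=
    f (xag t k.-1) + chi (xag t k.-1)
    - gamma / (2 * trial_beta k j) * enorm (trial2 t k j - xag t k.-1) ^+ 2
    + k%:R^-1.

Definition betak k : R := trial_beta k (tau2 t k).
Definition xbar k : V := trial2 t k (tau2 t k).
Definition xtilde k : V := trial_xtilde k (tau1 t k).

Definition ghat k : V := (betak k)^-1 *: (xag t k.-1 - xbar k).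

(* Each line search stops at the first successful trial, so the minimizers    *)
(* are only required to exist for the trials up to that one.                  *)
Record upfag_iteration (k : nat) : Prop := UpfagIteration {
  hlambda_gt0 : 0 < hlambda t k;
  trial1_min : forall j, (j <= tau1 t k)%N ->
    is_argmin X (subproblem1 k j) (trial1 t k j);
  tau1_success : linesearch1 k (tau1 t k);
  tau1_smallest : forall j, (j < tau1 t k)%N -> ~ linesearch1 k j;
  lamkE : lamk t k = trial_lambda k (tau1 t k);
  xkE : xk t k = trial1 t k (tau1 t k);
  hbeta_gt0 : 0 < hbeta t k;
  Gk_sym : symmetric (Gk t k);
  Gk_ge : loewner_ge (Gk t k) sigma%:M;
  trial2_min : forall j, (j <= tau2 t k)%N ->
    is_argmin X (subproblem2 k j) (trial2 t k j);
  tau2_success : linesearch2 k (tau2 t k);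
  tau2_smallest : forall j, (j < tau2 t k)%N -> ~ linesearch2 k j;
  xag_choice : [\/ xag t k = xag t k.-1, xag t k = xbar k | xag t k = xtilde k];
  xag_min : let Psi u := f u + chi u in
    Psi (xag t k)
      = Num.min (Psi (xag t k.-1)) (Num.min (Psi (xbar k)) (Psi (xtilde k)))
}.

Record upfag_run (x0 : V) : Prop := UpfagRun {
  x0_in : X x0;
  gamma_bounds : 0 < gamma < sigma;
  sigma_lt1 : sigma < 1;
  gamma1_bounds : 0 < gamma1 < 1;
  gamma2_bounds : 0 < gamma2 < 1;
  delta_gt0 : 0 < delta;
  xag0E : xag t 0 = x0;
  xk0E : xk t 0 = x0;
  upfag_steps : forall k, (1 <= k)%N -> upfag_iteration k
}.

End Method.

Section Consistency.
Context {R : realType}.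

Lemma is_diff_gradient_on n (X : set 'cV[R]_n) (f : 'cV[R]_n -> R) df :
  (forall x, X x -> is_diff x (f : _ -> R^o) (dot (df x) : _ -> R^o)) ->
  gradient_on X f df.
Proof.
move=> fdf x /fdf dfx e e0; have [dif dE] := dfx.
have normle (z : 'cV[R]_n) : `|z| <= enorm z.
  rewrite [leLHS]mx_normrE; apply/bigmax_leP.
  split => [|[i j] _]; first exact: sqrtr_ge0.
  rewrite /= (ord1 j) -sqrtr_sqr ler_wsqrtr// expr2 /dot (bigD1 i)//=.
  by rewrite lerDl sumr_ge0// => k _; rewrite -expr2 sqr_ge0.
suff : \forall y \near x, `|f y - f x - dot (df x) (y - x)| <= e * `|y - x|.
  move=> h; near=> y; apply: (@le_trans _ _ (e * `|y - x|)).
    by near: y; exact: cvg_within.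
  by rewrite ler_wpM2l ?normle// ltW.
have /eqaddoP/(_ _ e0) := diff_locally dif.
rewrite (near_shift 0 x); apply: filterS => z /=.
rewrite !fctE /= subr0 addrK dE opprD addrA; exact.
Unshelve. all: by end_near. Qed.

Lemma hoelder_const_cvg1 (H : R) : 0 < H ->
  hoelder_const nu H @[nu --> 1^'-] --> hoelder_const 1 H.
Proof.
move=> H0.
pose w (nu : R) := (1 - nu) / 2 * ln ((1 + nu) / (1 - nu)).
have w0 : w nu @[nu --> 1^'-] --> 0.
  apply: (@squeeze_cvgr _ _ _ _ (fun=> 0) (fun nu => Num.sqrt ((1 - nu) * (1 + nu)))).
  - near=> nu.
    have nu1 : nu < 1 by near: nu; exact: nbhs_left_lt.
    have nu0 : 0 < nu by near: nu; exact: nbhs_left_gt.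
    have q0 : 0 < (1 + nu) / (1 - nu) by rewrite divr_gt0 ?subr_gt0// addr_gt0.
    apply/andP; split.
      rewrite mulr_ge0 ?divr_ge0 ?subr_ge0 ?(ltW nu1)// ln_ge0//.
      by rewrite ler_pdivlMr ?subr_gt0// mul1r; lra.
    rewrite /w -[in ln _](sqr_sqrtr (ltW q0)) lnXn ?sqrtr_gt0//.
    rewrite [leLHS](_ : _ = (1 - nu) * ln (Num.sqrt ((1 + nu) / (1 - nu))));
      last by rewrite -mulr_natr; field.
    apply: (@le_trans _ _ ((1 - nu) * Num.sqrt ((1 + nu) / (1 - nu)))).
      by rewrite ler_pM2l ?subr_gt0// ltW// ln_sublinear// sqrtr_gt0.
    rewrite -{1}(ger0_norm (_ : 0 <= 1 - nu)) ?subr_ge0 ?(ltW nu1)//.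
    rewrite -sqrtr_sqr -sqrtrM ?sqr_ge0// ler_wsqrtr// le_eqVlt.
    apply/orP; left; apply/eqP; field; lra.
  - exact: cvg_cst.
  - rewrite -[X in _ --> X](_ : Num.sqrt ((1 - 1) * (1 + 1)) = 0 :> R); last first.
      by rewrite subrr mul0r sqrtr0.
    apply: continuous_cvg; first exact: sqrt_continuous.
    apply: cvg_at_left_filter; apply: cvgM.
      by apply: cvgB; [exact: cvg_cst|exact: cvg_id].
    by apply: cvgD; [exact: cvg_cst|exact: cvg_id].
rewrite {2}/hoelder_const eqxx -(@lnK _ (H / 2)) ?posrE ?divr_gt0//.
rewrite -[X in expR X](_ : 2 / (1 + 1) * (ln (H / 2) - 0) = _); last first.
  by rewrite subr0 divff ?mul1r// -?natrD ?pnatr_eq0.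
apply: (@cvg_trans _ (expR (2 / (1 + nu) * (ln (H / 2) - w nu)) @[nu --> 1^'-])).
  apply: near_eq_cvg; near=> nu.
  have nu1 : nu < 1 by near: nu; exact: nbhs_left_lt.
  have nu0 : 0 < nu by near: nu; exact: nbhs_left_gt.
  have q0 : 0 < (1 + nu) / (1 - nu) by rewrite divr_gt0 ?subr_gt0// addr_gt0.
  set c := H / (2 * ((1 + nu) / (1 - nu)) `^ ((1 - nu) / 2)).
  have c0 : 0 < c by rewrite divr_gt0// mulr_gt0 ?powR_gt0.
  rewrite /hoelder_const lt_eqF// -/c /powR gt_eqF//; congr (expR (_ * _)).
  by rewrite /c invfM mulrA [RHS]ln_div ?posrE ?divr_gt0 ?powR_gt0// ln_powR.
apply: continuous_cvg; first exact: continuous_expR.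
apply: cvgM; last by apply: cvgB => //; exact: cvg_cst.
apply: cvgM; first exact: cvg_cst.
apply: cvg_at_left_filter; apply: cvgV; first lra.
by apply: cvgD; [exact: cvg_cst|exact: cvg_id].
Unshelve. all: by end_near. Qed.

End Consistency.

(* Main.v *)
Require Import Defs.
From HB Require Import structures.
From mathcomp Require Import all_boot all_order all_algebra.
From mathcomp Require Import all_classical all_reals all_analysis.
From mathcomp Require Import ring lra.

Set Implicit Arguments.
Unset Strict Implicit.
Unset Printing Implicit Defensive.
Import Order.TTheory GRing.Theory Num.Theory.
Import numFieldNormedType.Exports.
Local Open Scope classical_set_scope.
Local Open Scope ring_scope.

(* Write a = (1 - nu) / (1 + nu) and p = 2 - a = (1 + 3 nu) / (1 + nu). By    *)
(* Young's inequality, for every d > 0 the function f has the quadratic       *)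
(* upper model with curvature 2 L / d ^ a, up to the additive error d. A      *)
(* failed trial of a line search, read against this model with d the slack    *)
(* that the search allows, bounds the trial stepsize from below.              *)
(*                                                                            *)
(* (a) The slack is d = 1/k, so 1 / beta_k <= (1/beta + 2 L k ^ a /           *)
(* (2 sigma - gamma)) / gamma2. The second line search makes beta_k |g_k|^2   *)
(* telescope up to 1/k; summing over N/2 < k <= N only keeps the harmonic     *)
(* contribution below 1.                                                      *)
(*                                                                            *)
(* (b) The accelerated estimate gives Psi(x_N) - Psi(u) <=                    *)
(* |x0 - u|^2 / (2 Lam_N) + delta. The slack is d = delta alpha_k, hence      *)
(* Lam_k alpha_k ^ p >= c := gamma1 / (2 L / delta ^ a + 1 / lambda). By      *)
(* Bernoulli's inequality Lam_k ^ (1/p) then grows by at least c ^ (1/p) / p  *)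
(* at each step, so Lam_N >= c (N / p) ^ p >= c N ^ p / 4.                    *)
(*                                                                            *)
(* Both bounds come out with smaller constants than claimed.                  *)

(** Two inequalities carry both parts. [hoelder_descent] bounds f by its linearization plus a power
    of the distance, and [hoelder_young] trades that power for a quadratic and an additive error;
    hence a trial can be rejected only if its stepsize exceeds a known bound ([betakV_le],
    [alpha_lower_bound]). [prox_three_point] turns minimality in a subproblem into quadratic growth
    around the minimizer, which gives the decrease [trial2_decrease] for (a) and the nearly monotone
    potential of [estimate_step] for (b). The rates are assembled in [min_sqr_ghat_le] and, through
    [powR_growth], in [convex_rate]. *)

Section Dot.
Context {R : realType} {n : nat}.
Implicit Types (u v w : 'cV[R]_n) (G : 'M[R]_n) (a : R).

Lemma dotC u v : dot u v = dot v u.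
Proof. by apply: eq_bigr => i _; rewrite mulrC. Qed.

Lemma dotDr u v w : dot u (v + w) = dot u v + dot u w.
Proof. by rewrite -big_split; apply: eq_bigr => i _; rewrite mxE mulrDr. Qed.

Lemma dotZr a u v : dot u (a *: v) = a * dot u v.
Proof. by rewrite mulr_sumr; apply: eq_bigr => i _; rewrite mxE mulrCA. Qed.

Lemma dotNr u v : dot u (- v) = - dot u v.
Proof. by rewrite -scaleN1r dotZr mulN1r. Qed.

Lemma dotBr u v w : dot u (v - w) = dot u v - dot u w.
Proof. by rewrite dotDr dotNr. Qed.

Lemma dotDl u v w : dot (v + w) u = dot v u + dot w u.
Proof. by rewrite !(dotC _ u) dotDr. Qed.

Lemma dotZl a u v : dot (a *: v) u = a * dot v u.
Proof. by rewrite !(dotC _ u) dotZr. Qed.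

Lemma dotNl u v : dot (- v) u = - dot v u.
Proof. by rewrite !(dotC _ u) dotNr. Qed.

Lemma dotBl u v w : dot (v - w) u = dot v u - dot w u.
Proof. by rewrite !(dotC _ u) dotBr. Qed.

Lemma dotvv_ge0 u : 0 <= dot u u.
Proof. by apply: sumr_ge0 => i _; rewrite -expr2 sqr_ge0. Qed.

Lemma dotvv_eq0 u : dot u u = 0 -> u = 0.
Proof.
move=> u0; apply/colP => i; rewrite mxE.
have /(_ i isT)/eqP : forall j, true -> u j 0 * u j 0 = 0.
  by apply: psumr_eq0P => // j _; rewrite -expr2 sqr_ge0.
by rewrite mulf_eq0 orbb => /eqP.
Qed.

Lemma enorm_ge0 u : 0 <= enorm u.
Proof. exact: sqrtr_ge0. Qed.

Lemma sqr_enorm u : enorm u ^+ 2 = dot u u.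
Proof. by rewrite sqr_sqrtr// dotvv_ge0. Qed.

Lemma enormZ a u : enorm (a *: u) = `|a| * enorm u.
Proof.
by rewrite /enorm dotZl dotZr mulrA -expr2 sqrtrM ?sqr_ge0// sqrtr_sqr.
Qed.

Lemma enormB u v : enorm (u - v) = enorm (v - u).
Proof. by rewrite -opprB -scaleN1r enormZ normrN1 mul1r. Qed.

(** Cauchy-Schwarz, from the nonnegative square of |v|^2 u - <u,v> v, which is |v|^2 (|u|^2 |v|^2 -
    <u,v>^2). *)
Lemma dot_le_enorm u v : dot u v <= enorm u * enorm v.
Proof.
have [v0|v0] := eqVneq (enorm v) 0.
  have -> : v = 0 by apply: dotvv_eq0; rewrite -sqr_enorm v0 expr0n.
  by rewrite -(scale0r 0) dotZr mul0r enormZ normr0 mul0r mulr0.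
have v_gt0 : 0 < enorm v by rewrite lt_def v0 enorm_ge0.
have [//|uv_gt0] := leP (dot u v) 0.
  by move=> /le_trans; apply; rewrite mulr_ge0 ?enorm_ge0.
have := dotvv_ge0 ((enorm v ^+ 2) *: u - (dot u v) *: v).
rewrite dotBl !dotBr !dotZl !dotZr (dotC v u) -!sqr_enorm => h.
have {}h : 0 <= enorm v ^+ 2 * ((enorm u * enorm v) ^+ 2 - dot u v ^+ 2).
  apply: le_trans h _; rewrite le_eqVlt; apply/orP; left; apply/eqP.
  by move: (enorm v) (enorm u) (dot u v) => *; ring.
rewrite -(ler_pXn2r (n := 2))// ?nnegrE ?mulr_ge0 ?enorm_ge0 ?(ltW uv_gt0)//.
by move: h; rewrite pmulr_rge0 ?subr_ge0// exprn_gt0.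
Qed.

Lemma enormG_sqr G u :
  0 <= dot (G *m u) u -> enormG G u ^+ 2 = dot (G *m u) u.
Proof. by move=> ?; rewrite sqr_sqrtr. Qed.

(* [G] need not be symmetric. *)
Lemma quad_convex_comb G (s : R) u v :
  dot (G *m (s *: u + (1 - s) *: v)) (s *: u + (1 - s) *: v) =
  s * dot (G *m u) u + (1 - s) * dot (G *m v) v
  - s * (1 - s) * dot (G *m (u - v)) (u - v).
Proof.
rewrite mulmxBr mulmxDr -!scalemxAr !(dotDl, dotNl, dotZl, dotDr, dotNr, dotZr).
ring.
Qed.

End Dot.

(** * Convexity, proximal steps and subgradients *)

Section Convex.
Context {R : realType} {n : nat}.
Local Notation V := 'cV[R]_n.
Implicit Types (X : set V) (f chi : V -> R) (x y z g : V).

Lemma convex_setE X (s : R) x y : convex_set X -> 0 <= s <= 1 ->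
  X x -> X y -> X (s *: x + (1 - s) *: y).
Proof.
move=> cX /andP[s0 s1] Xx Xy.
by have := cX x y (Itv01 s0 s1); rewrite !inE; exact.
Qed.

Lemma convex_functionE X f (s : R) x y : convex_function X f -> 0 <= s <= 1 ->
  X x -> X y -> f (s *: x + (1 - s) *: y) <= s * f x + (1 - s) * f y.
Proof.
move=> cf /andP[s0 s1] Xx Xy.
by have := cf (Itv01 s0 s1) x y; rewrite !inE; exact.
Qed.

(** The limit s -> 0+ made by hand: for B > 0, the choice s = e / (e + B) loses s B <= e. *)
Lemma ler_of_scaled (A B : R) :
  (forall s, 0 < s < 1 -> (1 - s) * B <= A) -> B <= A.
Proof.
move=> h; have [B0|B0] := leP B 0.
  by have := h 2^-1 _; rewrite invr_gt0 ltr0n invf_lt1 ?ltr1n// => /(_ isT); lra.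
apply/ler_addgt0Pr => e e0.
have s01 : 0 < e / (e + B) < 1.
  by rewrite divr_gt0 ?addr_gt0//= ltr_pdivrMr ?addr_gt0// mul1r ltrDl.
apply: le_trans (_ : (1 - e / (e + B)) * B + e <= _); last by rewrite lerD2r h.
rewrite mulrBl mul1r -addrA lerDl addrC subr_ge0 mulrAC ler_pdivrMr ?addr_gt0//.
by rewrite ler_pM2l// lerDr ltW.
Qed.

(** Compare z with s u + (1 - s) z. The quadratic obeys an exact identity and chi is convex, so
    minimality yields the growth term with a factor 1 - s, which [ler_of_scaled] removes. *)
Lemma prox_three_point X chi (G : 'M[R]_n) (b : R) x g z :
  convex_set X -> convex_function X chi ->
  let phi u := dot g u + b * dot (G *m (u - x)) (u - x) + chi u in
  is_argmin X phi z ->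
  forall u, X u -> phi z + b * dot (G *m (u - z)) (u - z) <= phi u.
Proof.
move=> cX cchi phi [Xz zmin] u Xu.
rewrite -lerBrDl; apply: ler_of_scaled => s /andP[s0 s1].
have s01 : 0 <= s <= 1 by rewrite !ltW.
have := zmin _ (convex_setE cX s01 Xu Xz).
have := convex_functionE cchi s01 Xu Xz; rewrite /phi.
have -> : s *: u + (1 - s) *: z - x = s *: (u - x) + (1 - s) *: (z - x).
  by rewrite !scalerBr addrACA -opprD -scalerDl [s + _]addrC subrK scale1r.
rewrite quad_convex_comb opprB addrA subrK (dotDr g) !(dotZr _ g) => h1 h2.
rewrite -(ler_pM2l s0); move: h1 h2.
move: (chi _) (dot (G *m _) _) (dot (G *m _) _) (dot (G *m _) _) => c q1 q2 q3.
nra.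
Qed.

(** The segment from x to y stays in X, so the relative expansion at x applies along it; dividing by
    s the chord inequality at a small s > 0 gives the claim up to e. *)
Lemma gradient_subgradient X f df : convex_set X -> convex_function X f ->
  gradient_on X f df -> subgradient_on X f df.
Proof.
move=> cX cf gf x y Xx Xy; apply/ler_addgt0Pr => e e0.
pose d := e / (enorm (y - x) + 1).
have N0 : 0 < enorm (y - x) + 1 by rewrite ltr_wpDl ?enorm_ge0.
have d0 : 0 < d by rewrite divr_gt0.
have c : (x + s *: (y - x)) @[s --> 0^'+] --> x.
  apply: cvg_at_right_filter.
  rewrite -[X in _ --> X]addr0 -[in X in _ --> X](scale0r (y - x)).
  apply: cvgD; first exact: cvg_cst.
  by apply: cvgZr_tmp; exact: cvg_id.
have /c/= := gf x Xx d d0.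
rewrite /within /= => near0.
have [s [s0 s1 hs]] : exists s : R, [/\ 0 < s, s < 1 &
    X (x + s *: (y - x)) ->
    `|f (x + s *: (y - x)) - f x - dot (df x) (x + s *: (y - x) - x)|
    <= d * enorm (x + s *: (y - x) - x)].
  near (0 : R)^'+ => s; exists s; split.
  - by near: s; exact: nbhs_right_gt.
  - by near: s; exact: nbhs_right_lt.
  - by near: s.
have s01 : 0 <= s <= 1 by rewrite !ltW.
have E : x + s *: (y - x) = s *: y + (1 - s) *: x.
  by rewrite scalerBr scalerBl scale1r addrCA.
have /hs : X (x + s *: (y - x)) by rewrite E; exact: convex_setE.
have -> : x + s *: (y - x) - x = s *: (y - x) by rewrite addrC addKr.
rewrite dotZr enormZ (ger0_norm (ltW s0)) E.
rewrite ler_norml => /andP[+ _].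
have := convex_functionE cf s01 Xy Xx.
move=> h1 h2.
have h3 : d * enorm (y - x) <= e.
  rewrite /d mulrAC ler_pdivrMr// ler_pM2l// lerDl ler01//.
have h4 : d * (s * enorm (y - x)) <= s * e by rewrite mulrCA ler_pM2l.
rewrite -(ler_pM2l s0) !mulrDr; lra.
Unshelve. all: by end_near. Qed.

End Convex.

(** * Scalar inequalities and the stepsize recursion *)

Section Scalar.
Context {R : realType}.
Implicit Types (a b c d r s x y p nu H : R).

(** Young's inequality with conjugate exponents 1/s and 1/(1-s); s = 0 and s = 1 are separate
    because one exponent would be infinite. *)
Lemma weighted_AM_GM s x y : 0 <= s <= 1 -> 0 <= x -> 0 <= y ->
  x `^ s * y `^ (1 - s) <= s * x + (1 - s) * y.
Proof.
move=> /andP[s0 s1] x0 y0.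
have [->|sn0] := eqVneq s 0; first by rewrite powRr0 subr0 powRr1//; lra.
have [->|sn1] := eqVneq s 1; first by rewrite subrr powRr0 powRr1//; lra.
have s_gt0 : 0 < s by rewrite lt_def sn0.
have s'_gt0 : 0 < 1 - s by rewrite subr_gt0 lt_neqAle sn1.
have := @conjugate_powR R (x `^ s) (y `^ (1 - s)) s^-1 (1 - s)^-1.
rewrite !invrK -!powRrM !mulfV ?gt_eqF// !powRr1// [x * _]mulrC [y * _]mulrC.
by apply; rewrite ?powR_ge0 ?invr_gt0//; lra.
Qed.

Lemma hoelder_const_gt0 nu H : 0 < H -> 0 <= nu <= 1 ->
  0 < hoelder_const nu H.
Proof.
move=> H0 /andP[nu0 nu1]; rewrite /hoelder_const; case: eqVneq => [_|nun1].
  by rewrite divr_gt0.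
have nu_lt1 : nu < 1 by rewrite lt_neqAle nun1.
by rewrite powR_gt0// divr_gt0// mulr_gt0// powR_gt0// divr_gt0; lra.
Qed.

(** For nu < 1 this is AM-GM with weight s = (1 + nu) / 2 on the quadratic, and [hoelder_const] is
    exactly the constant that makes the geometric mean equal to the left-hand side. *)
Lemma hoelder_young nu H d r : 0 < H -> 0 <= nu <= 1 -> 0 < d -> 0 <= r ->
  H / (1 + nu) * r `^ (1 + nu) <=
  hoelder_const nu H / d `^ ((1 - nu) / (1 + nu)) * r ^+ 2 + d.
Proof.
move=> H0 /andP[nu0 nu1] d0 r0.
have [nuE|nun1] := eqVneq nu 1.
  rewrite /hoelder_const nuE eqxx subrr mul0r powRr0 divr1.
  have -> : 1 + 1 = 2%:R :> R by [].
  by rewrite powR_mulrn// lerDl ltW.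
have nu_lt1 : nu < 1 by rewrite lt_neqAle nun1.
have L0 := hoelder_const_gt0 H0 (introT andP (conj nu0 nu1)).
set L := hoelder_const nu H in L0 *.
have [s sE] : exists s, s = (1 + nu) / 2 by eexists.
have [s0 s1] : 0 < s /\ 0 < 1 - s by rewrite sE; lra.
pose D := d `^ ((1 - nu) / (1 + nu)).
have D0 : 0 < D by rewrite powR_gt0.
have s01 : 0 <= s <= 1 by apply/andP; lra.
(* Terms chosen so that their weighted geometric mean is the left-hand side. *)
have := @weighted_AM_GM s (L / D / s * r ^+ 2) (d / (1 - s)) s01.
have -> : s * (L / D / s * r ^+ 2) = L / D * r ^+ 2 by field; rewrite !gt_eqF.
have -> : (1 - s) * (d / (1 - s)) = d by field; rewrite gt_eqF.
have LDs0 : 0 < L / D / s by rewrite !divr_gt0.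
move=> /(_ (mulr_ge0 (ltW LDs0) (sqr_ge0 r)) (ltW (divr_gt0 d0 s1))).
move/(le_trans _); apply.
rewrite powRM ?sqr_ge0 ?(ltW LDs0)//.
have -> : (r ^+ 2) `^ s = r `^ (1 + nu).
  by rewrite -powR_mulrn// -powRrM sE; congr (_ `^ _); field.
rewrite [leRHS]mulrAC ler_wpM2r ?powR_ge0// le_eqVlt; apply/orP; left; apply/eqP.
have nup : 0 < 1 + nu by lra.
have nup' : 0 < 1 - nu by lra.
have ds0 : 0 < d / (1 - s) by exact: divr_gt0.
(* Both coefficients are positive, so taking logarithms turns an identity between powers into a
   linear one. *)
apply: ln_inj; rewrite ?posrE; first exact: divr_gt0.
  by rewrite mulr_gt0 ?powR_gt0.
rewrite [RHS]lnM ?posrE ?powR_gt0// !ln_powR !ln_div ?posrE ?divr_gt0//.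
have -> : ln L = 2 / (1 + nu) *
    (ln H - (ln 2 + (1 - nu) / 2 * (ln (1 + nu) - ln (1 - nu)))).
  rewrite /L /hoelder_const (negbTE nun1) ln_powR ln_div ?posrE
    ?mulr_gt0 ?powR_gt0 ?divr_gt0//.
  by rewrite lnM ?posrE ?powR_gt0 ?divr_gt0// ln_powR ln_div.
have -> : 1 - s = (1 - nu) / 2 by rewrite sE; field.
rewrite sE /D ln_powR !ln_div ?posrE//.
by field; rewrite gt_eqF.
Qed.

Lemma bernoulli_powR s x : 0 <= s <= 1 -> 0 <= x -> x `^ s <= 1 + s * (x - 1).
Proof.
move=> s01 x0; have := weighted_AM_GM s01 x0 ler01.
by rewrite powR1 mulr1; lra.
Qed.

(** Bernoulli with exponent 1/p gives L k ^ (1/p) <= L k.+1 ^ (1/p) (1 - A k / p), while the last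
    hypothesis says L k.+1 ^ (1/p) A k >= c ^ (1/p). Hence the p-th roots grow at least linearly. *)
Lemma powR_growth (L A : nat -> R) c p : 0 < c -> 1 <= p <= 2 ->
  (forall k, 0 <= L k) ->
  (forall k, 0 < A k <= 1 /\
    L k = (1 - A k) * L k.+1 /\ c <= L k.+1 * A k `^ p) ->
  forall N, c * N%:R `^ p / 4 <= L N.
Proof.
move=> c0 /andP[p1 p2] L0 h N.
have p0 : 0 < p by lra.
have pn0 : p != 0 by rewrite gt_eqF.
have ip0 : 0 < p^-1 by rewrite invr_gt0.
have ip01 : 0 <= p^-1 <= 1 by rewrite ltW// invf_le1.
have step k : L k `^ p^-1 + c `^ p^-1 / p <= L k.+1 `^ p^-1.
  have [/andP[A0 A1] [LE cL]] := h k.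
  have : c `^ p^-1 <= L k.+1 `^ p^-1 * A k.
    rewrite -[A k](powRr1 (ltW A0)) -(mulfV pn0) powRrM -powRM ?powR_ge0//.
    by rewrite ge0_ler_powR ?nnegrE ?mulr_ge0 ?powR_ge0// ltW.
  move=> cA; rewrite LE powRM ?subr_ge0//.
  have := bernoulli_powR ip01 (_ : 0 <= 1 - A k); rewrite subr_ge0 => /(_ A1) b.
  have M0 : 0 <= L k.+1 `^ p^-1 by exact: powR_ge0.
  have := ler_wpM2l M0 b; have : c `^ p^-1 / p <= L k.+1 `^ p^-1 * A k / p.
    by rewrite ler_pM2r.
  by rewrite mulrC; lra.
have sum k : k%:R * (c `^ p^-1 / p) <= L k `^ p^-1.
  elim: k => [|k ih]; first by rewrite mul0r powR_ge0.
  apply: le_trans (step k); rewrite -natr1 mulrDl mul1r lerD2r//.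
have {}sum : (N%:R * (c `^ p^-1 / p)) `^ p <= L N.
  have -> : L N = (L N `^ p^-1) `^ p by rewrite -powRrM mulVf// powRr1.
  by rewrite ge0_ler_powR ?nnegrE ?mulr_ge0 ?powR_ge0// ltW.
apply: le_trans sum.
rewrite powRM ?mulr_ge0 ?powR_ge0 ?(ltW ip0)// powRM ?powR_ge0 ?(ltW ip0)//.
rewrite -powRrM mulVf ?gt_eqF// (powRr1 (ltW c0)) mulrCA -mulrA ler_pM2l//.
rewrite ler_wpM2l ?powR_ge0//.
rewrite -(powR_inv1 (ltW p0)) -powRrM mulN1r powRN lef_pV2 ?posrE ?powR_gt0//.
(* The 4 is the bound p ^ p <= 2 ^ p <= 2 ^ 2. *)
apply: le_trans (_ : 2 `^ p <= _).
  by rewrite ge0_ler_powR ?nnegrE// ltW.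
apply: le_trans (_ : 2 `^ 2%:R <= _); first by rewrite ler_powR// ler1n.
by rewrite powR_mulrn//; lra.
Qed.

Lemma ag_step_gt0 a b : 0 < a -> 0 <= b -> 0 < ag_step a b.
Proof. by move=> a0 b0; rewrite divr_gt0// ltr_wpDr ?sqrtr_ge0. Qed.

Lemma ag_step_sqr a b : 0 < a -> 0 <= b ->
  ag_step a b ^+ 2 = a * (b + ag_step a b).
Proof.
move=> a0 b0; have := sqr_sqrtr (_ : 0 <= a ^+ 2 + 4 * a * b).
rewrite addr_ge0 ?sqr_ge0 ?mulr_ge0 ?(ltW a0)// => /(_ isT).
by rewrite /ag_step; move: (Num.sqrt _) => q; lra.
Qed.

Lemma ag_weight_bounds a b : 0 < a -> 0 <= b -> 0 < ag_weight a b <= 1.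
Proof.
move=> a0 b0; have l0 := ag_step_gt0 a0 b0.
by rewrite divr_gt0 ?ltr_wpDl//= ler_pdivrMr ?ltr_wpDl// mul1r lerDr.
Qed.

Lemma ag_weight_step a b : 0 < a -> 0 <= b -> ag_weight a b * ag_step a b = a.
Proof.
move=> a0 b0; have l0 := ag_step_gt0 a0 b0.
by rewrite mulrAC -expr2 ag_step_sqr// mulfK// gt_eqF// ltr_wpDl.
Qed.

(** A rejected trial has a larger eta than the accepted one, hence a weight at least as large; this
    transfers its estimate to the accepted weight. *)
Lemma ler_ag_weight a a' b : 0 < a -> a <= a' -> 0 <= b ->
  ag_weight a b <= ag_weight a' b.
Proof.
move=> a0 aa' b0; have a'0 := lt_le_trans a0 aa'.
have l0 := ag_step_gt0 a0 b0; have l'0 := ag_step_gt0 a'0 b0.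
have ll' : ag_step a b <= ag_step a' b.
  rewrite ler_pM2r// lerD// ler_wsqrtr// lerD//.
    by rewrite ler_pXn2r ?nnegrE ?(ltW a0) ?(ltW a'0)//.
  by rewrite ler_wpM2r// ler_pM2l.
rewrite ler_pdivrMr ?ltr_wpDl// mulrAC ler_pdivlMr ?ltr_wpDl//.
by have := ler_wpM2r b0 ll'; nra.
Qed.

End Scalar.

(** * Upper bound on f from the Hoelder condition *)

Section Ascent.
Context {R : realType}.

(** The expansion is assumed only at points of [0, 1], all that a gradient relative to X provides on
    a segment; around an interior s these form a full neighbourhood. *)
Lemma expansion_is_derive (phi D : R -> R) (s : R) : 0 < s < 1 ->
  (forall e, 0 < e -> \forall u \near s, 0 <= u <= 1 ->
    `|phi u - phi s - D s * (u - s)| <= e * `|u - s|) ->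
  is_derive s 1 phi (D s).
Proof.
move=> /andP[s0 s1] h.
suff c : h^-1 *: (phi (h *: 1 + s) - phi s) @[h --> 0^'] --> D s.
  by split; [apply/cvg_ex; exists (D s)|exact/cvg_lim].
apply/cvgrPdist_le => e e0.
have near1 : \forall u \near s, 0 <= u <= 1.
  near=> u; apply/andP; split; apply: ltW; near: u.
  - exact: lt_nbhsr.
  - exact: lt_nbhsl.
have near2 : \forall u \near s,
    `|phi u - phi s - D s * (u - s)| <= e * `|u - s|.
  by apply: filterS2 (h e e0) near1 => u + u01; exact.
rewrite (near_shift 0 s) in near2; rewrite near_withinE.
apply: filterS near2 => u /=.
rewrite subr0 addrK [u *: 1]mulr1 => hu u0.
rewrite distrC [_ *: _]mulrC -(ler_pM2r (_ : 0 < `|u|)) ?normr_gt0//.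
by rewrite -normrM mulrBl divfK.
Unshelve. all: by end_near. Qed.

(** Serves the endpoints 0 and 1, where the expansion is one-sided but still gives the continuity
    that the monotonicity argument needs. *)
Lemma expansion_continuous (phi D : R -> R) (s : R) :
  (forall e, 0 < e -> \forall u \near s, 0 <= u <= 1 ->
    `|phi u - phi s - D s * (u - s)| <= e * `|u - s|) ->
  forall e, 0 < e -> \forall u \near s, 0 <= u <= 1 -> `|phi s - phi u| <= e.
Proof.
move=> h e e0; have D0 : 0 < `|D s| + 1 by rewrite ltr_wpDl.
have near1 : \forall u \near s, `|s - u| <= e / (`|D s| + 1).
  by have /cvgrPdist_le := @cvg_id _ (nbhs s); apply; exact: divr_gt0.
apply: filterS2 (h 1 ltr01) near1 => u + hu u01 => /(_ u01) {}h.
rewrite distrC -[phi u - _](subrK (D s * (u - s))).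
apply: le_trans (ler_normD _ _) _; rewrite normrM.
apply: le_trans (_ : (`|D s| + 1) * `|u - s| <= _).
  by rewrite mulrDl addrC lerD2l.
by rewrite mulrC -ler_pdivlMr// distrC.
Qed.

(** Instead of integrating D, subtract s D 0 + K s ^ (1 + nu) / (1 + nu) from phi: the difference
    has nonpositive derivative inside and is continuous up to the ends. *)
Lemma hoelder_segment (phi D : R -> R) (K nu : R) : 0 <= nu ->
  (forall s : R, 0 <= s <= 1 -> forall e : R, 0 < e ->
    \forall u \near s, 0 <= u <= 1 ->
    `|phi u - phi s - D s * (u - s)| <= e * `|u - s|) ->
  (forall s : R, 0 < s < 1 -> D s - D 0 <= K * s `^ nu) ->
  phi 1 <= phi 0 + D 0 + K / (1 + nu).
Proof.
move=> nu0 hphi hD.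
have nu1 : 0 < 1 + nu by lra.
pose g s := phi s - s * D 0 - K / (1 + nu) * s `^ (1 + nu).
have dg (s : R) : 0 < s < 1 -> is_derive s 1 g (D s - D 0 - K * s `^ nu).
  move=> s01; have s0 : 0 < s by case/andP: s01.
  have dphi := expansion_is_derive s01 (hphi s _).
  have {}dphi : is_derive s 1 phi (D s).
    by apply: dphi; case/andP: s01 => *; rewrite !ltW.
  have dp := is_derive1_powR (1 + nu) s0.
  have -> : g = phi - (D 0 \*: (id : R -> R^o))
      - (K / (1 + nu)) \*: (@powR R ^~ (1 + nu) : R -> R^o).
    by apply/funext => u; rewrite /g /= !fctE [u * _]mulrC.
  apply: is_derive_eq.
  rewrite [_ *: _]mulr1 [(K / _) *: _]mulrA divfK ?gt_eqF//.
  by congr (_ - _ * _ `^ _); ring.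
suff : g 1 <= g 0.
  rewrite /g mul1r mul0r powR1 powR0 ?gt_eqF// mulr0 mulr1; lra.
apply: (@ler0_derive1_nincr _ g 0 1) => //.
- by move=> s; rewrite in_itv/= => /dg[].
- move=> s; rewrite in_itv/= => s01; have [_ dE] := dg _ s01.
  by rewrite derive1E dE subr_le0 hD.
apply/continuous_within_itvP => //; split.
- move=> s; rewrite in_itv/= => /dg[d _].
  exact/differentiable_continuous/derivable1_diffP.
- rewrite /g mul0r powR0 ?gt_eqF// mulr0.
  apply: cvgB; first apply: cvgB.
  + apply/cvgrPdist_le => e e0.
    have := expansion_continuous (hphi 0 _) e0.
    rewrite lexx ler01 => /(_ isT) h.
    near=> u; have -> // : 0 <= u <= 1 -> `|phi 0 - phi u| <= e.
      by near: u; exact: cvg_within h.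
    by apply/andP; split; near: u; [exact: nbhs_right_ge|exact: nbhs_right_le].
  + rewrite -[X in _ --> X](mul0r (D 0)); apply: cvgMr_tmp.
    exact: cvg_at_right_filter.
  + rewrite -[X in _ --> X](mulr0 (K / (1 + nu))); apply: cvgMl_tmp.
    exact: powR_cvg0.
- rewrite /g; apply: cvgB; first apply: cvgB.
  + apply/cvgrPdist_le => e e0.
    have := expansion_continuous (hphi 1 _) e0.
    rewrite lexx ler01 => /(_ isT) h.
    near=> u; have -> // : 0 <= u <= 1 -> `|phi 1 - phi u| <= e.
      by near: u; exact: cvg_within h.
    by apply/andP; split; near: u; [exact: nbhs_left_ge|exact: nbhs_left_le].
  + apply: cvgMr_tmp; exact: cvg_at_left_filter.
  + apply: cvgMl_tmp; apply: cvg_at_left_filter.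
    have [+ _] := is_derive1_powR (1 + nu) (@ltr01 R).
    by move=> /derivable1_diffP/differentiable_continuous; exact.
Unshelve. all: by end_near. Qed.


(** For a gradient, restrict f to the segment, where the slope rises by at most H r ^ (1 + nu) s ^
    nu with r = |y - x|. For subgradients nu = 0, and the subgradient inequality at y with
    Cauchy-Schwarz suffices. *)
Lemma hoelder_descent n (X : set 'cV[R]_n) f df (H nu : R) : convex_set X ->
  0 <= H -> 0 <= nu -> smooth_or_subgradient X f df nu ->
  hoelder_on X H nu df ->
  forall x y, X x -> X y ->
  f y <= f x + dot (df x) (y - x) + H / (1 + nu) * enorm (y - x) `^ (1 + nu).
Proof.
move=> cX H0 nu0 + hdf x y Xx Xy.
have E s : 0 <= s <= 1 -> X (x + s *: (y - x)).
  move=> s01; have := convex_setE cX s01 Xy Xx.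
  by rewrite scalerBr scalerBl scale1r addrCA.
set v := y - x; pose r := enorm v.
have r0 : 0 <= r by exact: enorm_ge0.
have nu1 : 1 + nu != 0 by rewrite gt_eqF// ltr_wpDr.
case=> [gf|[nuE _ sf]]; last first.
  have := sf y x Xy Xx; rewrite -opprB dotNr -/v => h1.
  have := dot_le_enorm (df y - df x) v; rewrite dotBl => h2.
  have := ler_wpM2r r0 (hdf x y Xx Xy).
  rewrite -/v nuE powRr0 mulr1 addr0 divr1 powRr1// => h3.
  rewrite -/r in h2 *; lra.
pose D s := dot (df (x + s *: v)) v.
have := @hoelder_segment (fun s => f (x + s *: v)) D (H * r `^ (1 + nu)) nu nu0.
rewrite /D scale1r scale0r addr0 [x + v]addrC subrK => h.
rewrite [H / _ * _]mulrAC; apply: h => [s s01 e e0|s /andP[s0 s1]].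
  have r1 : 0 < r + 1 by rewrite ltr_wpDl.
  have c : (x + u *: v) @[u --> s] --> x + s *: v.
    by apply: cvgD; [exact: cvg_cst|apply: cvgZr_tmp; exact: cvg_id].
  have /c near_s := gf _ (E _ s01) _ (divr_gt0 e0 r1).
  have {}near_s : \forall u \near s, X (x + u *: v) ->
      `|f (x + u *: v) - f (x + s *: v)
        - dot (df (x + s *: v)) (x + u *: v - (x + s *: v))|
      <= e / (r + 1) * enorm (x + u *: v - (x + s *: v)) by exact: near_s.
  apply: filterS near_s => u + u01 => /(_ (E _ u01)).
  have -> : x + u *: v - (x + s *: v) = (u - s) *: v.
    by rewrite opprD addrACA subrr add0r scalerBl.
  rewrite dotZr enormZ [_ * dot _ _]mulrC -/r => /le_trans; apply.
  rewrite mulrCA [leRHS]mulrC ler_wpM2l// mulrAC ler_pdivrMr//.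
  by rewrite ler_pM2l// lerDl.
have s01 : 0 <= s <= 1 by rewrite !ltW.
rewrite -dotBl; apply: le_trans (dot_le_enorm _ _) _.
apply: le_trans (ler_wpM2r r0 (hdf _ _ Xx (E _ s01))) _.
rewrite addrC addKr enormZ ger0_norm ?(ltW s0)// -/r powRM ?(ltW s0)//.
rewrite powRD; last by rewrite (negbTE nu1).
rewrite powRr1// le_eqVlt; apply/orP; left; apply/eqP; ring.
Qed.

End Ascent.

(** * Invariants of a run *)

Section Run.
Context {R : realType} {n : nat}.
Context {X : set 'cV[R]_n} {f chi : 'cV[R]_n -> R} {df : 'cV[R]_n -> 'cV[R]_n}.
Context {H nu gamma sigma gamma1 gamma2 delta : R} {x0 : 'cV[R]_n}.
Context {t : @upfag_trace R n}.
Context (X_convex : convex_set X) (chi_convex : convex_function X chi)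
  (H_gt0 : 0 < H) (nu_itv : 0 <= nu <= 1)
  (f_df : smooth_or_subgradient X f df nu) (df_hoelder : hoelder_on X H nu df)
  (run : upfag_run X f chi df gamma sigma gamma1 gamma2 delta t x0).

Local Notation Psi u := (f u + chi u).
Local Notation L := (hoelder_const nu H).
Local Notation a := ((1 - nu) / (1 + nu)).
Local Notation p := ((1 + 3 * nu) / (1 + nu)).
Local Notation alpha k := (trial_alpha gamma1 t k (tau1 t k)).

Lemma smooth_quadratic x y d : X x -> X y -> 0 < d ->
  f y <= f x + dot (df x) (y - x) + (L / d `^ a * enorm (y - x) ^+ 2 + d).
Proof.
move=> Xx Xy d0; have /andP[nu0 _] := nu_itv.
have := hoelder_descent X_convex (ltW H_gt0) nu0 f_df df_hoelder Xx Xy.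
move=> /le_trans; apply.
by rewrite lerD2l hoelder_young// enorm_ge0.
Qed.

Lemma LamkS k : Lamk t k.+1 = Lamk t k + lamk t k.+1.
Proof. by rewrite /Lamk big_nat_recr. Qed.

Lemma Lamk0 : Lamk t 0 = 0.
Proof. by rewrite /Lamk big_geq. Qed.

Lemma trial_eta_gt0 k j : 0 < trial_eta gamma1 t k.+1 j.
Proof.
have /andP[g0 _] := gamma1_bounds run.
by rewrite mulr_gt0 ?exprn_gt0// (hlambda_gt0 (upfag_steps run (ltn0Sn k))).
Qed.

Lemma trial_beta_gt0 k j : 0 < trial_beta gamma2 t k.+1 j.
Proof.
have /andP[g0 _] := gamma2_bounds run.
by rewrite mulr_gt0 ?exprn_gt0// (hbeta_gt0 (upfag_steps run (ltn0Sn k))).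
Qed.

Lemma ag_comb_in (s : R) x y : 0 < s <= 1 -> X x -> X y -> X (ag_comb s x y).
Proof.
move=> /andP[s0 s1] Xx Xy; rewrite /ag_comb addrC.
by apply: convex_setE => //; rewrite ltW.
Qed.

Lemma run_invariant k : [/\ X (xag t k), X (xk t k) & 0 <= Lamk t k].
Proof.
elim: k => [|k [Xag Xk Lam0]].
  by rewrite (xag0E run) (xk0E run) Lamk0; split => //; exact: x0_in run.
have it := upfag_steps run (ltn0Sn k).
have [X1 _] := trial1_min it (leqnn _); have [X2 _] := trial2_min it (leqnn _).
have eta0 := trial_eta_gt0 k (tau1 t k.+1).
split.
- case: (xag_choice it) => -> //.
  by apply: ag_comb_in => //; exact: ag_weight_bounds.
- by rewrite (xkE it).
- by rewrite LamkS addr_ge0// (lamkE it) ltW// ag_step_gt0.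
Qed.

Lemma trial_alpha_bounds k j : 0 < trial_alpha gamma1 t k.+1 j <= 1.
Proof.
have [_ _ ?] := run_invariant k.
by apply: ag_weight_bounds; rewrite ?trial_eta_gt0.
Qed.

Lemma lamk_gt0 k : 0 < lamk t k.+1.
Proof.
have [_ _ ?] := run_invariant k.
by rewrite (lamkE (upfag_steps run (ltn0Sn k))) ag_step_gt0// trial_eta_gt0.
Qed.

Lemma Lamk_gt0 k : 0 < Lamk t k.+1.
Proof. by have [_ _ ?] := run_invariant k; rewrite LamkS ltr_wpDl ?lamk_gt0. Qed.

Lemma lamkE_alpha k : lamk t k.+1 = alpha k.+1 * Lamk t k.+1.
Proof.
rewrite LamkS (lamkE (upfag_steps run (ltn0Sn k))) /trial_alpha /ag_weight divfK//.
rewrite -/(trial_lambda gamma1 t k.+1 (tau1 t k.+1)).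
by rewrite -(lamkE (upfag_steps run (ltn0Sn k))) -LamkS gt_eqF// Lamk_gt0.
Qed.

Lemma Lamk_shrink k : Lamk t k = (1 - alpha k.+1) * Lamk t k.+1.
Proof. by rewrite mulrBl mul1r -lamkE_alpha LamkS addrK. Qed.

Lemma Psi_xag_le k :
  [/\ Psi (xag t k.+1) <= Psi (xag t k),
      Psi (xag t k.+1) <= Psi (xbar t k.+1) &
      Psi (xag t k.+1) <= Psi (xtilde gamma1 t k.+1)].
Proof.
have /= -> := xag_min (upfag_steps run (ltn0Sn k)).
by rewrite !ge_min !lexx !orbT.
Qed.

Lemma Psi_xag_homo k m : (k <= m)%N -> Psi (xag t m) <= Psi (xag t k).
Proof.
elim: m => [|m ih]; first by rewrite leqn0 => /eqP ->.
rewrite leq_eqVlt ltnS => /predU1P[->//|/ih]; apply: le_trans.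
by have [] := Psi_xag_le m.
Qed.

(** * Part (a): decrease of Psi and the projected gradient *)

(** The three-point inequality tested at [xag t k] counts the quadratic twice, so the coefficient is
    sigma / beta and not sigma / (2 beta). Against gamma / (2 beta) in the search, this leaves the
    factor 2 sigma - gamma. *)
Lemma trial2_decrease k j : (j <= tau2 t k.+1)%N ->
  dot (df (xag t k)) (trial2 t k.+1 j - xag t k)
    + chi (trial2 t k.+1 j) - chi (xag t k) <=
  - (sigma / trial_beta gamma2 t k.+1 j)
    * enorm (trial2 t k.+1 j - xag t k) ^+ 2.
Proof.
set x := xag t k; set z := trial2 _ _ _ => jk.
have it := upfag_steps run (ltn0Sn k).
have b0 := trial_beta_gt0 k j; set b := trial_beta _ _ _ _ in b0 *.
have /andP[gm0 gs] := gamma_bounds run; have s0 := lt_trans gm0 gs.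
have Gs u : sigma * enorm u ^+ 2 <= dot (Gk t k.+1 *m u) u.
  have := Gk_ge it u; rewrite mulmxBl mul_scalar_mx dotBl dotZl sqr_enorm.
  by rewrite subr_ge0.
have [Xx _ _] := run_invariant k.
have := trial2_min it jk.
have -> : subproblem2 chi df gamma2 t k.+1 j = fun u =>
    dot (df x) u + (2 * b)^-1 * dot (Gk t k.+1 *m (u - x)) (u - x) + chi u.
  apply/funext => u; rewrite /subproblem2 enormG_sqr//.
  by apply: le_trans (Gs _); rewrite mulr_ge0 ?sqr_ge0 ?(ltW s0).
move=> /(prox_three_point X_convex chi_convex)/(_ _ Xx).
rewrite subrr mulmx0 [dot 0 0](_ : _ = 0); last first.
  by rewrite -(scale0r 0) dotZr mul0r.
rewrite mulr0 addr0 -/z (dotBr (df x)).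
have -> : dot (Gk t k.+1 *m (x - z)) (x - z) =
    dot (Gk t k.+1 *m (z - x)) (z - x).
  by rewrite -opprB mulmxN dotNr dotNl opprK.
move: (Gs (z - x)); set Q := dot (_ *m _) _ => hQ h.
have := ler_wpM2l (ltW (_ : 0 < b^-1)) hQ; rewrite invr_gt0 => /(_ b0).
move: h; rewrite invfM. lra.
Qed.

Lemma betak_gt0 k : 0 < betak gamma2 t k.+1.
Proof. exact: trial_beta_gt0. Qed.

Lemma betakV_le (beta : R) : 0 < beta ->
  (forall k, (1 <= k)%N -> beta <= hbeta t k) ->
  forall k, (betak gamma2 t k.+1)^-1 <=
    gamma2^-1 * (beta^-1 + 2 * L / (2 * sigma - gamma) * k.+1%:R `^ a).
Proof.
move=> beta0 hb k; have it := upfag_steps run (ltn0Sn k).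
have /andP[gm0 gs] := gamma_bounds run.
have /andP[g20 g21] := gamma2_bounds run.
have L0 := hoelder_const_gt0 H_gt0 nu_itv.
have sg0 : 0 < 2 * sigma - gamma by lra.
have E0 : 0 <= 2 * L / (2 * sigma - gamma) * k.+1%:R `^ a.
  by rewrite mulr_ge0 ?powR_ge0// ltW// divr_gt0// mulr_gt0.
have bV0 : 0 < beta^-1 by rewrite invr_gt0.
case tauE : (tau2 t k.+1) => [|j].
  rewrite /betak tauE /trial_beta expr0 mulr1.
  apply: le_trans (_ : beta^-1 <= _).
    by rewrite lef_pV2 ?posrE ?(hbeta_gt0 it)// hb.
  have : 1 <= gamma2^-1 by rewrite invf_ge1// ltW.
  nra.
have jlt : (j < tau2 t k.+1)%N by rewrite tauE.
have b0 := trial_beta_gt0 k j.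
have fail := tau2_smallest it jlt.
have dec := trial2_decrease (ltnW jlt).
have -> : betak gamma2 t k.+1 = gamma2 * trial_beta gamma2 t k.+1 j.
  by rewrite /betak tauE /trial_beta exprS mulrCA.
rewrite invfM ler_pM2l ?invr_gt0//.
have [Xx _ _] := run_invariant k.
have [Xz _] := trial2_min it (ltnW jlt).
have k0 : 0 < k.+1%:R^-1 :> R by rewrite invr_gt0.
have := smooth_quadratic Xx Xz k0.
have -> : L / (k.+1%:R^-1) `^ a = L * k.+1%:R `^ a.
  by rewrite -(powR_inv1 (ler0n _ _)) -powRrM mulN1r powRN invrK.
move: dec; rewrite /=; move/negP: fail; rewrite -ltNge /=.
set b := trial_beta _ _ _ _ in b0 *; set K := _ `^ a in E0 *.
set z := trial2 _ _ _; set x := xag _ _.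
rewrite invfM; set q := enorm _ ^+ 2 => h1 h2 h3.
have q0 : 0 <= q by exact: sqr_ge0.
(* Otherwise the model with error 1/k and the proximal decrease would imply the search condition
   that this trial failed. *)
have {}h : (2 * sigma - gamma) * b^-1 < 2 * (L * K).
  rewrite ltNge; apply/negP => le.
  have := ler_wpM2l q0 le; move: (k.+1%:R^-1) h1 h2 h3 => kk; lra.
apply: le_trans (_ : 2 * L / (2 * sigma - gamma) * K <= _).
  by rewrite mulrAC ler_pdivlMr// mulrC -mulrA ltW.
by rewrite lerDr ltW.
Qed.


Lemma sqr_ghat_le k :
  gamma / 2 * (betak gamma2 t k.+1 * enorm (ghat gamma2 t k.+1) ^+ 2) <=
  Psi (xag t k) - Psi (xag t k.+1) + k.+1%:R^-1.
Proof.
have b0 := betak_gt0 k.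
have := tau2_success (upfag_steps run (ltn0Sn k)).
have [_ + _] := Psi_xag_le k.
rewrite /linesearch2 -/(xbar t k.+1) -/(betak gamma2 t k.+1) /=.
rewrite /ghat /= enormZ exprMn [in enorm _ ^+ 2]enormB gtr0_norm ?invr_gt0//.
set q := enorm _ ^+ 2; set b := betak _ _ _ in b0 *.
have -> : b * (b^-1 ^+ 2 * q) = b^-1 * q by field; rewrite gt_eqF.
by rewrite invfM; move: (k.+1%:R^-1) => kk; lra.
Qed.

(** At most [N./2.+1] terms, each at most the inverse of that number. Dropping the early indices
    avoids the logarithm of the full harmonic sum. *)
Lemma sum_inv_half N :
  \sum_(N./2 <= k < N) (k.+1%:R^-1 : R) <= 1.
Proof.
have h0 : 0 < (N./2.+1)%:R :> R by [].
apply: le_trans (_ : \sum_(N./2 <= k < N) ((N./2.+1)%:R^-1 : R) <= _).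
  rewrite big_nat [leRHS]big_nat; apply: ler_sum => k /andP[k1 _].
  by rewrite lef_pV2 ?posrE// ler_nat.
rewrite sumr_const_nat -[_ *+ _]mulr_natr mulrC ler_pdivrMr// mul1r ler_nat.
by rewrite leq_subLR addnS addnn -[leqLHS]odd_double_half; case: (odd N) => //=.
Qed.

Lemma min_sqr_ghat_le (beta : R) : 0 < beta ->
  (forall k, (1 <= k)%N -> beta <= hbeta t k) ->
  has_lbound [set Psi u | u in X] ->
  forall N, (1 <= N)%N ->
  \big[Num.min/enorm (ghat gamma2 t 1) ^+ 2]_(1 <= k < N.+1)
    enorm (ghat gamma2 t k) ^+ 2 <=
  4 * (Psi x0 - inf [set Psi u | u in X] + 1) / (gamma * gamma2)
  * (2 * L / ((2 * sigma - gamma) * N%:R `^ (2 * nu / (1 + nu)))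
     + (beta * N%:R)^-1).
Proof.
move=> beta0 hb lb N N1.
have /andP[gm0 gs] := gamma_bounds run.
have /andP[g20 g21] := gamma2_bounds run.
have /andP[nu0 nu1] := nu_itv.
have L0 := hoelder_const_gt0 H_gt0 nu_itv.
have sg0 : 0 < 2 * sigma - gamma by lra.
have N0 : 0 < N%:R :> R by rewrite ltr0n.
set M := \big[_/_]_(_ <= _ < _) _.
have M0 : 0 <= M by apply: le_bigmin => [|k _]; exact: sqr_ge0.
pose E := beta^-1 + 2 * L / (2 * sigma - gamma) * N%:R `^ a.
have E0 : 0 < E.
  by rewrite ltr_pwDl ?invr_gt0// mulr_ge0 ?powR_ge0// ltW// divr_gt0// mulr_gt0.
have a0 : 0 <= a by rewrite divr_ge0; lra.
(* The left side is uniform in k: M is the minimum, and k.+1 ^ a <= N ^ a because a >= 0. *)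
have Mk k : (k < N)%N -> gamma / 2 * (gamma2 / E * M) <=
    Psi (xag t k) - Psi (xag t k.+1) + k.+1%:R^-1.
  move=> kN; apply: le_trans (sqr_ghat_le k).
  rewrite ler_pM2l ?divr_gt0//.
  have b0 := betak_gt0 k.
  apply: ler_pM => //; first by rewrite ltW// divr_gt0.
    rewrite -[leLHS]invrK -[leRHS]invrK lef_pV2 ?posrE ?invr_gt0 ?divr_gt0//.
    rewrite invf_div mulrC; apply: le_trans (betakV_le beta0 hb k) _.
    rewrite ler_pM2l ?invr_gt0// lerD2l ler_wpM2l//.
      by rewrite ltW// divr_gt0// mulr_gt0.
    by rewrite ge0_ler_powR ?nnegrE// ler_nat.
  by apply: bigmin_inf_seq (lexx _) => //; rewrite mem_index_iota ltnS.
have : \sum_(N./2 <= k < N) (gamma / 2 * (gamma2 / E * M)) <=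
    \sum_(N./2 <= k < N) (Psi (xag t k) - Psi (xag t k.+1) + k.+1%:R^-1).
  by rewrite big_nat [leRHS]big_nat; apply: ler_sum => k /andP[_ /Mk].
rewrite sumr_const_nat -[_ *+ _]mulr_natr big_split /=.
have -> : \sum_(N./2 <= k < N) (Psi (xag t k) - Psi (xag t k.+1)) =
    Psi (xag t N./2) - Psi (xag t N).
  under eq_bigr do rewrite -opprB.
  rewrite sumrN telescope_sumr ?opprB//.
  by rewrite -{2}(odd_double_half N) -addnn addnA leq_addl.
have := sum_inv_half N; set S := \sum_(_ <= _ < _) _.
have := Psi_xag_homo (leq0n N./2); rewrite (xag0E run).
have [XN _ _] := run_invariant N.
have : inf [set Psi u | u in X] <= Psi (xag t N).
  by apply: ge_inf => //; exists (xag t N).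
set Ps := inf _; set D := Psi x0 - Ps + 1.
move=> h1 h2 h3 h4.
have {h1 h2 h3 h4} h : gamma / 2 * (gamma2 / E * M) * (N - N./2)%:R <= D.
  by rewrite /D; apply: le_trans h4 _; lra.
(* At least half of the indices are summed; with the 2 of gamma / 2 this makes the constant 4. *)
have hN : N%:R / 2 <= (N - N./2)%:R :> R.
  rewrite ler_pdivrMr// -natrM ler_nat.
  rewrite -{1 2}(odd_double_half N) -[in leqRHS]addnn addnA addnK.
  by rewrite mulnDl muln2 muln2 leq_add2r -addnn leq_addr.
have c0 : 0 <= gamma / 2 * (gamma2 / E * M).
  by rewrite mulr_ge0 ?divr_ge0 ?(ltW gm0)// mulr_ge0// ltW// divr_gt0.
have {}h := le_trans (ler_wpM2l c0 hN) h.
have -> : 2 * L / ((2 * sigma - gamma) * N%:R `^ (2 * nu / (1 + nu)))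
     + (beta * N%:R)^-1 = E / N%:R.
  have Na : N%:R `^ a * N%:R `^ (2 * nu / (1 + nu)) = N%:R.
    rewrite -powRD; last by rewrite (gt_eqF N0) implybT.
    have -> : a + 2 * nu / (1 + nu) = 1 by field; lra.
    by rewrite powRr1.
  have Np0 : 0 < N%:R `^ (2 * nu / (1 + nu)) :> R by exact: powR_gt0.
  rewrite /E [RHS]mulrDl [LHS]addrC [(beta * _)^-1]invfM; congr (_ + _).
  rewrite -[X in _ = _ / X]Na; field.
  by rewrite !gt_eqF// powR_gt0.
rewrite -[_ / _ * (E / _)]mulrA [leRHS](_ : _ =
  D * (4 * E / (gamma * gamma2 * N%:R))); last by field; rewrite !gt_eqF.
have e0 : 0 <= 4 * E / (gamma * gamma2 * N%:R).
  by rewrite ltW// divr_gt0 ?mulr_gt0.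
apply: le_trans (ler_wpM2r e0 h); rewrite le_eqVlt; apply/orP; left; apply/eqP.
by field; rewrite !gt_eqF.
Qed.

(** * Part (b): the accelerated estimate *)

(** The potential of accelerated methods rises only by the search error delta alpha, weighted by
    Lam. The subgradient inequality at [trial_xmd] is applied to [xag t k] with weight 1 - alpha and
    to u with weight alpha; as [trial_xmd] mixes [xag t k] and [xk t k] with these weights, the
    linear terms cancel against the three-point inequality. *)
Lemma estimate_step : convex_function X f -> forall u, X u -> forall k,
  Lamk t k.+1 * (Psi (xag t k.+1) - Psi u) + enorm (u - xk t k.+1) ^+ 2 / 2 <=
  Lamk t k * (Psi (xag t k) - Psi u) + enorm (u - xk t k) ^+ 2 / 2
  + delta * lamk t k.+1.
Proof.
move=> cf u Xu k; have it := upfag_steps run (ltn0Sn k).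
have sf : subgradient_on X f df.
  by case: f_df => [|[]//]; exact: gradient_subgradient.
have [Xag Xk _] := run_invariant k.
have l0 := lamk_gt0 k; have Lam0 := Lamk_gt0 k.
have al_bnd := trial_alpha_bounds k (tau1 t k.+1).
have /andP[al0 al1] := al_bnd.
have [Xz _] := trial1_min it (leqnn _).
have Xmd : X (trial_xmd gamma1 t k.+1 (tau1 t k.+1)) by exact: ag_comb_in.
have [_ _ PsiS] := Psi_xag_le k.
have ls := tau1_success it.
rewrite /linesearch1 /= -(lamkE it) -/(xtilde gamma1 t k.+1) in ls.
have chit : chi (xtilde gamma1 t k.+1) <=
    alpha k.+1 * chi (xk t k.+1) + (1 - alpha k.+1) * chi (xag t k).
  rewrite (xkE it) /xtilde /trial_xtilde /ag_comb addrC.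
  by apply: convex_functionE => //; rewrite al1 ltW.
have prox : dot (df (trial_xmd gamma1 t k.+1 (tau1 t k.+1))) (xk t k.+1)
      + (2 * lamk t k.+1)^-1 * enorm (xk t k.+1 - xk t k) ^+ 2
      + chi (xk t k.+1) + (2 * lamk t k.+1)^-1 * enorm (u - xk t k.+1) ^+ 2 <=
    dot (df (trial_xmd gamma1 t k.+1 (tau1 t k.+1))) u
      + (2 * lamk t k.+1)^-1 * enorm (u - xk t k) ^+ 2 + chi u.
  have := trial1_min it (leqnn _).
  have -> : subproblem1 chi df gamma1 t k.+1 (tau1 t k.+1) = fun v =>
      dot (df (trial_xmd gamma1 t k.+1 (tau1 t k.+1))) v + (2 * lamk t k.+1)^-1
      * dot (1%:M *m (v - xk t k)) (v - xk t k) + chi v.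
    by apply/funext => v; rewrite /subproblem1 mul1mx sqr_enorm (lamkE it).
  move=> /(prox_three_point X_convex chi_convex)/(_ _ Xu).
  by rewrite !mul1mx -!sqr_enorm -(xkE it).
have sag := sf _ _ Xmd Xag; have su := sf _ _ Xmd Xu.
have mdE : dot (df (trial_xmd gamma1 t k.+1 (tau1 t k.+1)))
      (trial_xmd gamma1 t k.+1 (tau1 t k.+1)) =
    (1 - alpha k.+1) * dot (df (trial_xmd gamma1 t k.+1 (tau1 t k.+1))) (xag t k)
    + alpha k.+1 * dot (df (trial_xmd gamma1 t k.+1 (tau1 t k.+1))) (xk t k).
  by rewrite {2}/trial_xmd /ag_comb dotDr !dotZr.
rewrite -(xkE it) !dotBr ?mdE in ls sag su.
have lE := lamkE_alpha k.
move: ls chit prox sag su PsiS; rewrite !invfM.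
set al := alpha k.+1 in al0 al1 lE *; set w := 2^-1 / _.
set qz := enorm (u - xk t k.+1) ^+ 2; set qu := enorm (u - xk t k) ^+ 2.
move=> ls chit prox sag su PsiS.
have key : Psi (xag t k.+1) <= (1 - al) * Psi (xag t k) + al * Psi u
    + al * w * (qu - qz) + delta * al.
  have al1' : 0 <= 1 - al by rewrite subr_ge0.
  have {}prox := ler_wpM2l (ltW al0) prox.
  have {}su := ler_wpM2l (ltW al0) su.
  have {}sag := ler_wpM2l al1' sag.
  lra.
have {}key := ler_wpM2l (ltW Lam0) key.
(* The weights satisfy lambda = alpha Lam, so multiplying by Lam leaves 1/2 on the squared
   distances. *)
have E : Lamk t k.+1 * (al * w * (qu - qz)) = qu / 2 - qz / 2.
  by rewrite /w lE; field; rewrite !gt_eqF.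
rewrite (Lamk_shrink k) -/al.
rewrite lE; move: (w) E key => w' E key; lra.
Qed.

(** The accepted eta is Lam alpha ^ 2, and p + a = 2 reduces the claim to a lower bound on eta by a
    multiple of alpha ^ a. Without backtracking, eta >= lambda and alpha ^ a <= 1 give it; otherwise
    the last rejected trial does. *)
Lemma alpha_lower_bound (lambda : R) : 0 < lambda ->
  (forall k, (1 <= k)%N -> lambda <= hlambda t k) -> forall k,
  gamma1 / (2 * L / delta `^ a + lambda^-1) <= Lamk t k.+1 * alpha k.+1 `^ p.
Proof.
move=> lambda0 hl k; have it := upfag_steps run (ltn0Sn k).
have [Xag Xk Lam0] := run_invariant k.
have d0 := delta_gt0 run.
have /andP[g10 g11] := gamma1_bounds run.
have /andP[nu0 nu1] := nu_itv.
have L0 := hoelder_const_gt0 H_gt0 nu_itv.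
have da0 : 0 < delta `^ a by exact: powR_gt0.
have a0 : 0 <= a by rewrite divr_ge0; lra.
have /andP[al0 al1] := trial_alpha_bounds k (tau1 t k.+1).
have ala0 : 0 < alpha k.+1 `^ a by exact: powR_gt0.
have C0 : 0 < 2 * L / delta `^ a + lambda^-1.
  by rewrite addr_gt0 ?invr_gt0// divr_gt0// mulr_gt0.
have etaE : trial_eta gamma1 t k.+1 (tau1 t k.+1) =
    Lamk t k.+1 * alpha k.+1 ^+ 2.
  rewrite expr2 mulrA [Lamk _ _ * _]mulrC -lamkE_alpha (lamkE it) mulrC.
  by rewrite ag_weight_step// trial_eta_gt0.
suff h : gamma1 * alpha k.+1 `^ a <=
    (2 * L / delta `^ a + lambda^-1) * trial_eta gamma1 t k.+1 (tau1 t k.+1).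
  rewrite ler_pdivrMr// -(ler_pM2r ala0); apply: le_trans h _.
  have E : alpha k.+1 `^ p * alpha k.+1 `^ a = alpha k.+1 ^+ 2.
    rewrite -powRD; last by rewrite (gt_eqF al0) implybT.
    have -> : p + a = 2%:R by field; lra.
    by rewrite powR_mulrn ?(ltW al0).
  by rewrite etaE -E le_eqVlt; apply/orP; left; apply/eqP; ring.
have [tauE|tau0] := posnP (tau1 t k.+1).
  have -> : trial_eta gamma1 t k.+1 (tau1 t k.+1) = hlambda t k.+1.
    by rewrite /trial_eta tauE expr0 mulr1.
  have := hl k.+1 isT; rewrite -(ler_pM2l (_ : 0 < lambda^-1)) ?invr_gt0//.
  rewrite mulVf ?gt_eqF// => h1.
  have h2 : alpha k.+1 `^ a <= 1.
    have : alpha k.+1 `^ a <= 1 `^ a by rewrite ge0_ler_powR ?nnegrE ?(ltW al0).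
    by rewrite powR1.
  have h3 : 0 <= 2 * L / delta `^ a * hlambda t k.+1.
    by rewrite mulr_ge0// ltW ?(hlambda_gt0 it)// divr_gt0// mulr_gt0.
  have h4 : gamma1 * alpha k.+1 `^ a <= 1 by rewrite mulr_ile1// ?ltW.
  apply: le_trans h4 _; apply: le_trans h1 _. by rewrite [leRHS]mulrDl lerDr.
have [j tauE] : exists j, tau1 t k.+1 = j.+1.
  by exists (tau1 t k.+1).-1; rewrite prednK.
have etaS : trial_eta gamma1 t k.+1 (tau1 t k.+1) =
    gamma1 * trial_eta gamma1 t k.+1 j.
  by rewrite /trial_eta tauE exprS mulrCA.
have jlt : (j < tau1 t k.+1)%N by rewrite tauE.
have [Xz _] := trial1_min it (ltnW jlt).
have fail := tau1_smallest it jlt.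
have eta0 := trial_eta_gt0 k j.
have al'_bnd := trial_alpha_bounds k j; have /andP[al'0 al'1] := al'_bnd.
have alle : alpha k.+1 <= trial_alpha gamma1 t k.+1 j.
  apply: ler_ag_weight => //; first exact: trial_eta_gt0.
  by rewrite etaS ger_pMl// ltW.
have := ag_weight_step eta0 Lam0.
rewrite -/(trial_lambda gamma1 t k.+1 j) -/(trial_alpha gamma1 t k.+1 j).
have l0 : 0 < trial_lambda gamma1 t k.+1 j by exact: ag_step_gt0.
rewrite etaS.
have Xmd : X (trial_xmd gamma1 t k.+1 j) by exact: ag_comb_in.
have Xt : X (trial_xtilde gamma1 t k.+1 j) by exact: ag_comb_in.
have := smooth_quadratic Xmd Xt (mulr_gt0 d0 al'0).
(* Only the second point of the combination changes, so the model's quadratic gains a factor alpha ^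
   2. *)
have -> : trial_xtilde gamma1 t k.+1 j - trial_xmd gamma1 t k.+1 j =
    trial_alpha gamma1 t k.+1 j *: (trial1 t k.+1 j - xk t k).
  rewrite /trial_xtilde /trial_xmd /ag_comb opprD addrACA subrr add0r.
  by rewrite -scalerBr.
rewrite dotZr enormZ (gtr0_norm al'0) exprMn.
move/negP: fail; rewrite -ltNge /=.
set l := trial_lambda _ _ _ _ in l0 *.
set b := trial_alpha _ _ _ _ in al'0 al'1 alle *.
set q := enorm _ ^+ 2 => h1 h2 bl.
have q0 : 0 <= q by exact: sqr_ge0.
rewrite -bl mulrCA ler_pM2l//.
rewrite powRM ?(ltW d0) ?(ltW al'0)// in h2.
have b_a0 : 0 < b `^ a by exact: powR_gt0.
(* Otherwise the model with error delta b would imply the failed search condition. *)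
have hlt : b / (2 * l) < L / (delta `^ a * b `^ a) * b ^+ 2.
  by rewrite ltNge; apply/negP => le; have := ler_wpM2r q0 le; lra.
apply: le_trans (_ : b `^ a <= _).
  by rewrite ge0_ler_powR ?nnegrE ?(ltW al0) ?(ltW al'0).
apply: le_trans (_ : 2 * L / delta `^ a * (b * l) <= _); last first.
  by rewrite ler_wpM2r ?lerDl ?invr_ge0 ?ltW// mulr_gt0.
have : b^-1 * (delta `^ a * b `^ a) * (2 * l) * (b / (2 * l)) <=
    b^-1 * (delta `^ a * b `^ a) * (2 * l) *
    (L / (delta `^ a * b `^ a) * b ^+ 2).
  apply: ler_wpM2l (ltW hlt).
  apply/ltW/mulr_gt0; last exact: mulr_gt0.
  by apply: mulr_gt0; [rewrite invr_gt0|exact: mulr_gt0].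
have -> : b^-1 * (delta `^ a * b `^ a) * (2 * l) * (b / (2 * l)) =
    delta `^ a * b `^ a by field; rewrite !gt_eqF.
move=> h; rewrite -(ler_pM2l da0); apply: le_trans h _.
rewrite le_eqVlt; apply/orP; left; apply/eqP.
by field; rewrite !gt_eqF.
Qed.

Lemma estimate_sum u : convex_function X f -> X u -> forall k,
  Lamk t k * (Psi (xag t k) - Psi u) <=
  enorm (x0 - u) ^+ 2 / 2 + delta * Lamk t k.
Proof.
move=> cf Xu k.
suff : Lamk t k * (Psi (xag t k) - Psi u) + enorm (u - xk t k) ^+ 2 / 2 <=
    enorm (x0 - u) ^+ 2 / 2 + delta * Lamk t k.
  by have := sqr_ge0 (enorm (u - xk t k)); lra.
elim: k => [|k ih].
  by rewrite Lamk0 !mul0r mulr0 add0r addr0 (xk0E run) enormB.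
have := estimate_step cf Xu k; have := congr1 ( *%R delta) (LamkS k).
by rewrite mulrDr; lra.
Qed.

Lemma convex_rate (lambda : R) u : 0 < lambda ->
  (forall k, (1 <= k)%N -> lambda <= hlambda t k) ->
  convex_function X f -> is_argmin X (fun u => Psi u) u ->
  forall N, (1 <= N)%N ->
  Psi (xag t N) - Psi u <=
    2 * enorm (x0 - u) ^+ 2 / (gamma1 * N%:R `^ p)
    * (2 * L / delta `^ a + lambda^-1) + delta.
Proof.
move=> lambda0 hl cf [Xu _] N N1.
have /andP[g10 _] := gamma1_bounds run.
have /andP[nu0 nu1] := nu_itv.
have L0 := hoelder_const_gt0 H_gt0 nu_itv.
have C0 : 0 < 2 * L / delta `^ a + lambda^-1.
  by rewrite addr_gt0 ?invr_gt0// divr_gt0 ?mulr_gt0// powR_gt0// (delta_gt0 run).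
have Np0 : 0 < N%:R `^ p :> R by rewrite powR_gt0// ltr0n.
have p12 : 1 <= p <= 2 by rewrite ler_pdivlMr ?ler_pdivrMr; lra.
have c0 := divr_gt0 g10 C0.
have Lam_ge0 k : 0 <= Lamk t k by case: (run_invariant k).
have growth := powR_growth (A := fun k => alpha k.+1) c0 p12 Lam_ge0 _ N.
have {}growth := growth (fun k => conj (trial_alpha_bounds _ _)
  (conj (Lamk_shrink k) (alpha_lower_bound lambda0 hl k))).
have := estimate_sum cf Xu N.
case: N N1 Np0 growth => // N _ Np0 growth.
have Lam0 := Lamk_gt0 N.
set D := _ - Psi u; set r := enorm _ ^+ 2; set Lam := Lamk _ _ in growth Lam0 *.
have r0 : 0 <= r by exact: sqr_ge0.
move=> h; have {}h : D <= r / 2 / Lam + delta.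
  by rewrite -lerBlDr ler_pdivlMr// mulrBl mulrC; lra.
apply: le_trans h _; rewrite lerD2r ler_pdivrMr//.
set C := _ + _ in C0 growth *; set Np := _ `^ p in growth Np0 *.
(* The factor 2 r C / (gamma1 N ^ p) times the lower bound gamma1 N ^ p / (4 C) of Lam is exactly r
   / 2, whence the constant 2. *)
apply: le_trans (ler_wpM2l _ growth); last first.
  apply: mulr_ge0 (ltW C0); apply: divr_ge0; first exact: mulr_ge0.
  exact/ltW/mulr_gt0.
by rewrite le_eqVlt; apply/orP; left; apply/eqP; field; rewrite !gt_eqF.
Qed.

End Run.

Theorem corollary5 (R : realType) (n : nat) (X : set 'cV[R]_n)
    (f chi : 'cV[R]_n -> R) (df : 'cV[R]_n -> 'cV[R]_n) (H nu : R)
    (gamma sigma gamma1 gamma2 delta : R) (x0 : 'cV[R]_n)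
    (t : upfag_trace) (lambda beta : R)
    (X_closed : closed X) (X_convex : convex_set X)
    (chi_convex : convex_function X chi)
    (H_gt0 : 0 < H) (nu_itv : 0 <= nu <= 1)
    (f_df : smooth_or_subgradient X f df nu)
    (df_hoelder : hoelder_on X H nu df)
    (run : upfag_run X f chi df gamma sigma gamma1 gamma2 delta t x0)
    (lambda_gt0 : 0 < lambda) (beta_gt0 : 0 < beta)
    (hlambda_ge : forall k, (1 <= k)%N -> lambda <= hlambda t k)
    (hbeta_ge : forall k, (1 <= k)%N -> beta <= hbeta t k) :
  let Psi u := f u + chi u in
  let Psi_star := inf [set Psi u | u in X] in
  let L := hoelder_const nu H in
  let g k := enorm (ghat gamma2 t k) ^+ 2 in
  (has_lbound [set Psi u | u in X] ->
    forall N, (1 <= N)%N ->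
      \big[Num.min/g 1%N]_(1 <= k < N.+1) g k <=
        8 * (Psi x0 - Psi_star + 1) / (gamma * gamma2)
        * (8 * L / ((2 * sigma - gamma) * N%:R `^ (2 * nu / (1 + nu)))
           + (beta * N%:R)^-1))
  /\
  (convex_function X f ->
    forall xstar, is_argmin X Psi xstar ->
    forall N, (1 <= N)%N ->
      Psi (xag t N) - Psi xstar <=
        4 * enorm (x0 - xstar) ^+ 2
          / (gamma1 * N%:R `^ ((1 + 3 * nu) / (1 + nu)))
        * (2 * L / delta `^ ((1 - nu) / (1 + nu)) + lambda^-1)
        + delta).
Proof.
move=> Psi Psi_star L g.
have L0 : 0 < L by exact: hoelder_const_gt0.
have /andP[gm0 gs] := gamma_bounds run.
have /andP[g10 _] := gamma1_bounds run.
have /andP[g20 _] := gamma2_bounds run.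
have sg0 : 0 < 2 * sigma - gamma by lra.
split=> [lb N N1|f_convex xstar xstar_min N N1].
  have N0 : 0 < N%:R :> R by rewrite ltr0n.
  have c0 : 0 <= Psi x0 - Psi_star + 1.
    rewrite addr_ge0// subr_ge0; apply: ge_inf => //.
    by exists x0 => //; exact: x0_in run.
  (* This bound has 4 and 2 L where 8 and 8 L are claimed; [c0] allows each factor to be enlarged
     separately. *)
  apply: le_trans (min_sqr_ghat_le X_convex chi_convex H_gt0 nu_itv f_df
    df_hoelder run beta_gt0 hbeta_ge lb N1) _.
  rewrite -/Psi_star -/L -/(Psi x0); apply: ler_pM.
  - by rewrite divr_ge0 ?mulr_ge0 ?(ltW gm0) ?(ltW g20).
  - by rewrite addr_ge0 ?invr_ge0 ?divr_ge0 ?mulr_ge0 ?powR_ge0 ?(ltW L0)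
      ?(ltW sg0) ?(ltW beta_gt0).
  - rewrite ler_wpM2r ?invr_ge0 ?mulr_ge0 ?(ltW gm0) ?(ltW g20)//.
    by rewrite ler_wpM2r// ler_nat.
  - rewrite lerD2r ler_wpM2r ?invr_ge0 ?mulr_ge0 ?powR_ge0 ?(ltW sg0)//.
    by rewrite ler_wpM2r ?(ltW L0)// ler_nat.
apply: le_trans (convex_rate X_convex chi_convex H_gt0 nu_itv f_df df_hoelder
  run lambda_gt0 hlambda_ge f_convex xstar_min N1) _.
rewrite lerD2r ler_wpM2r//.
  by rewrite addr_ge0 ?divr_ge0 ?invr_ge0 ?mulr_ge0 ?powR_ge0 ?(ltW L0)
    ?(ltW lambda_gt0).
rewrite ler_wpM2r ?invr_ge0 ?mulr_ge0 ?powR_ge0 ?(ltW g10)//.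
by rewrite ler_wpM2r ?sqr_ge0// ler_nat.
Qed.
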